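(* For every integer $d \geq 1$, $c(d) \leq i(d) \leq b(d) \leq c(d+1)$, where $i(d)$ is the maximum number of edges of an invertibility critical hypergraph of degree $d$, $b(d)$ is the maximum cardinality of a minimal edge cover of degree $d$ of a complete bipartite graph, and $c(d)$ is the maximum cardinality of a minimal edge cover of degree $d$ of a complete graph.
   Context: A hypergraph $\mathbf{H} = (\mathcal{H}, V)$ consists of a finite vertex set $V$ and a family $\mathcal{H}$ of subsets of $V$ (the edges). $\mathbf{H}$ is invertible iff there exists a permutation $\pi$ of $V$ with $\pi(E) \cap E = \emptyset$ for all $E \in \mathcal{H}$, where $\pi(E)=\{\pi(x)\mid x\in E\}$. $\mathbf{H}$ is invertibility critical iff it is not invertible but $(\mathcal{H}\setminus\{E\}, V)$ is invertible for every $E \in \mathcal{H}$. A family $\mathcal{H}$ of subsets of a set $V$ has degree $d$ if every $x \in V$ belongs to at most $d$ members of $\mathcal{H}$. For a finite graph $G$, a family $\mathcal{H}$ of subsets of $V(G)$ is an edge cover of $G$ iff every edge $e$ of $G$ (viewed as a 2-element vertex set) is included in some $E \in \mathcal{H}$; it is a minimal edge cover iff no proper subfamily $\mathcal{H}' \subsetneq \mathcal{H}$ is an edge cover of $G$. *)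

(* Defs.v *)
From mathcomp Require Import all_boot all_fingroup.

Set Implicit Arguments.
Unset Strict Implicit.
Unset Printing Implicit Defensive.

(* A hypergraph is a finite vertex type V with an edge set H : {set {set V}}. *)

Definition invertible (V : finType) (H : {set {set V}}) : Prop :=
  exists pi : {perm V}, forall E : {set V}, E \in H -> (pi @: E) :&: E = set0.

Definition invertibility_critical (V : finType) (H : {set {set V}}) : Prop :=
  ~ invertible H /\ (forall E : {set V}, E \in H -> invertible (H :\ E)).

(* "Degree d" is an upper bound on the vertex degrees, not an exact value. *)
Definition has_degree (V : finType) (d : nat) (H : {set {set V}}) : Prop :=
  forall x : V, #|[set E in H | x \in E]| <= d.

Record sgraph := SGraph {
  vertex :> finType;
  adj : rel vertex;
  adj_sym : symmetric adj;
  adj_irr : irreflexive adj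
}.

Definition complete (G : sgraph) : Prop :=
  forall x y : G, x != y -> adj x y.

(* The two vertex classes are A and its complement. *)
Definition complete_bipartite (G : sgraph) : Prop :=
  exists A : {set G}, forall x y : G, adj x y = ((x \in A) != (y \in A)).

Definition edge_cover (G : sgraph) (H : {set {set G}}) : Prop :=
  forall x y : G, adj x y -> exists2 E : {set G}, E \in H & [set x; y] \subset E.

Definition minimal_edge_cover (G : sgraph) (H : {set {set G}}) : Prop :=
  edge_cover H /\
  (forall H' : {set {set G}}, H' \proper H -> ~ edge_cover H').

Definition is_maximum (P : nat -> Prop) (m : nat) : Prop :=
  P m /\ (forall n : nat, P n -> n <= m).

Definition critical_size (d n : nat) : Prop :=
  exists (V : finType) (H : {set {set V}}),
    [/\ invertibility_critical H, has_degree d H & #|H| = n].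

Definition cover_size (C : sgraph -> Prop) (d n : nat) : Prop :=
  exists (G : sgraph) (H : {set {set G}}),
    [/\ C G, minimal_edge_cover H, has_degree d H & #|H| = n].

(* i(d) = m, b(d) = m and c(d) = m; each includes that the maximum exists. *)
Definition is_i (d : nat) : nat -> Prop := is_maximum (critical_size d).
Definition is_b (d : nat) : nat -> Prop :=
  is_maximum (cover_size complete_bipartite d).
Definition is_c (d : nat) : nat -> Prop := is_maximum (cover_size complete d).

(* Main.v *)
Require Import Defs.
From mathcomp Require Import all_boot all_fingroup.
From Stdlib Require Import Classical.

(* By Hall's theorem, [H] is not invertible iff there are sets [S], [T] of
   vertices with [#|S| + #|T| > #|V|] all of whose pairs in [S * T] are covered
   by [H].  So a critical hypergraph is a minimal cover of the bipartite graph
   on a disjoint union of [S] and [T].  Conversely, a minimal cover of a complete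
   graph becomes critical after padding with isolated vertices, and a bipartite
   cover becomes a cover of a complete graph after adding the two classes as
   edges.  Finiteness of c(d): the sets of edges through the vertices pairwise
   intersect and have at most [d] elements, and every edge is the exact
   intersection of two of them. *)

Set Implicit Arguments.
Unset Strict Implicit.
Unset Printing Implicit Defensive.

(** * Maxima of bounded predicates and Hall's marriage theorem *)

Lemma is_maximum_exists (P : nat -> Prop) (b n0 : nat) :
  P n0 -> (forall n, P n -> n <= b) -> exists m, is_maximum P m.
Proof.
elim: b => [|b IHb] Pn0 Pb; first by exists n0; split=> // n /Pb; rewrite leqn0 => /eqP ->.
have [Pb1|nPb1] := classic (P b.+1); first by exists b.+1.
apply: IHb => // n Pn; have := Pb n Pn; rewrite leq_eqVlt => /orP[/eqP eq_n|//].
by case: nPb1; rewrite -eq_n.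
Qed.

(** Induction on [#|A|]: either some nonempty proper subset of [A] is tight, having no more
    neighbours than elements, and it is matched separately from the rest, or one vertex is matched
    arbitrarily. *)
Lemma hall_matching (V : finType) (r : rel V) (A B : {set V}) :
    (forall S : {set V}, S \subset A ->
       #|S| <= #|[set y in B | [exists x in S, r x y]]|) ->
  exists2 f : V -> V, {in A &, injective f} &
    {in A, forall x, (f x \in B) && r x (f x)}.
Proof.
have [n] := ubnP #|A|; elim: n => // n IHn in A B *; rewrite ltnS => leAn hallA.
pose N (B' S : {set V}) := [set y in B' | [exists x in S, r x y]].
have [A0|[a aA]] := set_0Vmem A.
  by exists id => x; rewrite A0 inE.
case: (pickP (fun S : {set V} =>
    [&& S \proper A, S != set0 & #|N B S| <= #|S|])) => [S0|slack].
  case/and3P=> S0A S0n0 leN.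
  have S0subA := proper_sub S0A.
  have [||f0 f0inj f0B] := IHn S0 (N B S0).
  - exact: leq_trans (proper_card S0A) leAn.
  - move=> S SS0; apply: leq_trans (hallA S (subset_trans SS0 S0subA)) _.
    apply/subset_leq_card/subsetP=> y; rewrite !inE => /andP[-> /existsP[x /andP[xS rxy]]] /=.
    apply/andP; split; apply/existsP; exists x; rewrite rxy ?xS //.
    by rewrite (subsetP SS0).
  have [||f1 f1inj f1B] := IHn (A :\: S0) (B :\: N B S0).
  - apply: leq_trans leAn; apply: proper_card; apply/properP; split; first exact: subsetDl.
    by case/set0Pn: S0n0 => x xS0; exists x; rewrite ?inE ?xS0 // (subsetP S0subA).
  - move=> S SA; have SS0 : [disjoint S & S0].
      by have := SA; rewrite subsetD => /andP[].
    have US : S :|: S0 \subset A.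
      by rewrite subUset S0subA andbT (subset_trans SA) // subsetDl.
    (* Hall's condition for [S :|: S0] minus the tight count for [S0] leaves enough neighbours of
       [S] outside [N B S0]. *)
    have := hallA _ US; rewrite cardsU (disjoint_setI0 SS0) cards0 subn0 => le1.
    rewrite -(leq_add2r #|S0|); apply: leq_trans le1 _.
    apply: leq_trans (leq_add (leqnn _) leN).
    apply: leq_trans (leq_card_setU _ _).
    apply/subset_leq_card/subsetP=> y; rewrite !inE.
    case/andP=> -> /existsP[x /andP[]]; rewrite inE => /orP[] xS rxy /=.
      case: [exists x in S0, r x y] => //=; rewrite orbF.
      by apply/existsP; exists x; rewrite xS.
    by apply/orP; right; apply/existsP; exists x; rewrite xS.
  exists (fun x => if x \in S0 then f0 x else f1 x).
    move=> x y xA yA.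
    case: ifP => xS; case: ifP => yS.
    + exact: f0inj.
    + have /andP[] := f0B x xS => f0xN _ eqf.
      have := f1B y; rewrite !inE yS yA => /(_ isT); rewrite -eqf.
      by move: f0xN; rewrite inE => ->.
    + have /andP[] := f0B y yS => f0xN _ eqf.
      have := f1B x; rewrite !inE xS xA => /(_ isT); rewrite eqf.
      by move: f0xN; rewrite inE => ->.
    + by apply: f1inj; rewrite inE ?xS ?yS.
  move=> x xA /=; case: ifP => xS.
    have /andP[] := f0B x xS; by rewrite inE => /andP[-> _] ->.
  by have := f1B x; rewrite !inE xS xA => /(_ isT)/andP[/andP[_ ->] ->].
(* Without a tight set, every nonempty proper subset has a spare neighbour, so [a] may take any
   neighbour [b]. *)
have: 0 < #|N B [set a]|.
  by apply: leq_trans (hallA [set a] _); rewrite ?cards1 ?sub1set.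
case/card_gt0P=> b; rewrite inE => /andP[bB /existsP[a' /andP[/set1P -> rab]]].
have [||f finj fB] := IHn (A :\ a) (B :\ b).
- by apply: leq_trans leAn; rewrite (cardsD1 a A) aA.
- move=> S SA; have [->|Sn0] := eqVneq S set0; first by rewrite cards0.
  have := slack S; rewrite Sn0 /=.
  have -> /= : S \proper A by apply: sub_proper_trans SA _; rewrite properD1.
  move/negbT; rewrite -ltnNge => ltS.
  rewrite -ltnS; apply: leq_trans ltS _.
  rewrite (cardsD1 b (N B S)) -add1n; apply: leq_add; first by case: (_ \in _).
  by apply/subset_leq_card/subsetP=> y; rewrite !inE andbA.
exists (fun x => if x == a then b else f x).
  move=> x y xA yA.
  have fb z : z \in A -> z != a -> f z != b.
    by move=> zA zna; have := fB z; rewrite !inE zna zA => /(_ isT)/andP[/andP[]].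
  case: eqVneq => [->|xna]; case: eqVneq => [->|yna] //.
  + by move=> eqb; have := fb y yA yna; rewrite -eqb eqxx.
  + by move=> eqb; have := fb x xA xna; rewrite eqb eqxx.
  + by apply: finj; rewrite !inE ?xna ?yna.
move=> x xA /=; case: eqVneq => [->|xna]; first by rewrite bB.
by have := fB x; rewrite !inE xna xA => /(_ isT)/andP[/andP[_ ->] ->].
Qed.

(** * Private pairs in minimal edge covers *)

Lemma minimal_edge_coverP (G : sgraph) (H : {set {set G}}) :
  minimal_edge_cover H <->
  edge_cover H /\
  (forall E, E \in H -> exists x y : G, adj x y /\
     forall E', E' \in H -> x \in E' -> y \in E' -> E' = E).
Proof.
split=> -[covH minH]; split=> //.
  move=> E EH; apply: NNPP => no_private.
  apply: (minH (H :\ E)); first exact: properD1.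
  move=> x y xy; apply: NNPP => uncov; apply: no_private; exists x, y; split=> //.
  move=> E' E'H xE' yE'; apply: NNPP => /eqP neE; apply: uncov.
  by exists E'; rewrite ?inE ?neE // subUset !sub1set xE'.
move=> H' /properP[sH'H [E EH EnH']] covH'.
have [x [y [xy priv]]] := minH E EH.
have [E' E'H'] := covH' x y xy; rewrite subUset !sub1set => /andP[xE' yE'].
by move: EnH'; rewrite -(priv E' (subsetP sH'H _ E'H') xE' yE') E'H'.
Qed.

Lemma minimal_edge_cover_sub (G : sgraph) (H : {set {set G}}) :
  edge_cover H -> exists2 H' : {set {set G}}, H' \subset H & minimal_edge_cover H'.
Proof.
have [n] := ubnP #|H|; elim: n H => // n IHn H; rewrite ltnS => leHn covH.
have [minH|] := classic (minimal_edge_cover H); first by exists H.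
move=> nmin; have [H1 [pH1 cov1]] : exists H1 : {set {set G}}, H1 \proper H /\ edge_cover H1.
  by apply: NNPP => none; apply: nmin; split=> // H1 pH1 cov1; apply: none; exists H1.
have [H' sH' minH'] := IHn H1 (leq_trans (proper_card pH1) leHn) cov1.
by exists H' => //; apply: subset_trans sH' (proper_sub pH1).
Qed.

(** * Finiteness of c(d) *)

(* [X] is a partial transversal contained in [A].  As long as some member [F]
   of the family misses [X], the set [A] extends [X] by one of the at most [d]
   elements of [F]; once [X] meets every member, it meets [B] and so contains
   the single element of [A :&: B]. *)
Lemma intersecting_kernel (I : finType) (Fam : {set {set I}}) (d j : nat) (X : {set I}) :
    {in Fam, forall A : {set I}, #|A| <= d} ->
    {in Fam &, forall A B : {set I}, A :&: B != set0} ->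
    #|X| + j = d ->
  exists2 U : {set I}, #|U| <= d.+1 ^ j.+1 &
    forall A B k, A \in Fam -> B \in Fam -> X \subset A -> A :&: B = [set k] -> k \in U.
Proof.
move: j X => + + small inter.
pose kernel (X U : {set I}) := forall A B k,
  A \in Fam -> B \in Fam -> X \subset A -> A :&: B = [set k] -> k \in U.
have transversal (X : {set I}) i : #|X| + i = d ->
    (fun F : {set I} => (F \in Fam) && (F :&: X == set0)) =1 xpred0 ->
    exists2 U : {set I}, #|U| <= d.+1 ^ i.+1 & kernel X U.
  move=> cardX meets; exists X.
    apply: leq_trans (leq_pexp2l _ (ltn0Sn _)); rewrite // expn1 ltnW // ltnS.
    by rewrite -cardX leq_addr.
  move=> A B k AF BF sXA ABk; have := meets B; rewrite BF => /negbT/set0Pn[l].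
  rewrite inE => /andP[lB lX]; have: l \in A :&: B by rewrite inE lB (subsetP sXA).
  by rewrite ABk => /set1P <-.
elim=> [|j IHj] X cardX;
  case: (pickP (fun F : {set I} => (F \in Fam) && (F :&: X == set0)));
  try exact: transversal; move=> F /andP[FF /eqP FX0].
  (* Here [#|X| = d] forces [X = A], but [F] misses [X] while it must meet [A]: no such [A]
     exists. *)
  exists set0; first by rewrite cards0.
  move=> A B k AF BF sXA ABk.
  have eXA : X = A by apply/eqP; rewrite eqEcard sXA -[#|X|]addn0 cardX small.
  by have := inter _ _ FF AF; rewrite -eXA FX0 eqxx.
have /fin_all_exists[u hu] z : exists U : {set I},
    z \in F -> #|U| <= d.+1 ^ j.+1 /\ kernel (z |: X) U.
  case zF: (z \in F); last by exists set0.
  have [|U cU hU] := IHj (z |: X); last by exists U.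
  have zX : z \notin X.
    by apply/negP=> zX; have /setP/(_ z) := FX0; rewrite !inE zF zX.
  by rewrite cardsU1 zX -cardX add1n addSnnS.
(* [A] meets [F] in some [z], so the kernel for [z |: X] applies. There are at most [d] choices of
   [z], whence one more factor [d.+1]. *)
exists (\bigcup_(z in F) u z).
  apply: leq_trans (_ : \sum_(z in F) d.+1 ^ j.+1 <= _).
    apply: leq_trans (_ : \sum_(z in F) #|u z| <= _); last first.
      by apply: leq_sum => z /hu[].
    elim/big_rec2: _ => [|z m U _ le]; first by rewrite cards0.
    by apply: leq_trans (leq_card_setU _ _) _; rewrite leq_add2l.
  by rewrite sum_nat_const (expnS _ j.+1) leq_mul2r ltnW ?orbT // ltnS small.
move=> A B k AF BF sXA ABk.
have /set0Pn[z] := inter _ _ AF FF; rewrite inE => /andP[zA zF].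
apply/bigcupP; exists z => //; have [_ huz] := hu z zF.
by apply: (huz A B k) => //; rewrite subUset sub1set zA.
Qed.

Lemma complete_cover_size_bound (d n : nat) :
  cover_size complete d n -> n <= d.+1 ^ d.+1.
Proof.
case=> G [H [cG /minimal_edge_coverP[covH priv] degH <-]].
have [->|[E0 E0H]] := set_0Vmem H; first by rewrite cards0.
pose F x := [set E in H | x \in E].
have meet x y : x != y -> exists E, E \in F x :&: F y.
  move=> /cG/covH[E EH]; rewrite subUset !sub1set => /andP[xE yE].
  by exists E; rewrite !inE EH xE yE.
have Fn0 x y : F x :&: F y != set0.
  apply/set0Pn; have [<-|/meet//] := eqVneq x y.
  (* On the diagonal, [x] lies in some edge because it differs from [a] or from [b]. *)
  have [a [b [ab _]]] := priv E0 E0H.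
  have [xa|/meet[E]] := eqVneq x a; last by rewrite inE => /andP[Ex _]; exists E; rewrite inE Ex.
  have /meet[E] : x != b by apply/eqP=> xb; move: ab; rewrite -xa -xb adj_irr.
  by rewrite inE => /andP[Ex _]; exists E; rewrite inE Ex.
(* Starting from the empty transversal, all [d] extension steps remain. *)
have [|||U cU hU] := @intersecting_kernel _ [set F x | x : G] d d set0.
- by move=> _ /imsetP[x _ ->]; apply: degH.
- by move=> _ _ /imsetP[x _ ->] /imsetP[y _ ->].
- by rewrite cards0.
apply: leq_trans cU; apply/subset_leq_card/subsetP=> E EH.
have [x [y [xy xyE]]] := priv E EH.
apply: (hU (F x) (F y)); rewrite ?imset_f ?sub0set //.
apply/eqP; rewrite eqEsubset; have sub : F x :&: F y \subset [set E].
  apply/subsetP=> E'; rewrite !inE => /andP[/andP[E'H xE'] /andP[_ yE']].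
  by rewrite (xyE E').
rewrite sub sub1set; have /set0Pn[E' E'xy] := Fn0 x y.
by have /set1P <- := subsetP sub _ E'xy.
Qed.

(** * Hall's condition for invertibility, and c(d) <= i(d) *)

(** A permutation inverts [H] iff no vertex shares an edge with its image, and a matching of the
    finite set [V] into itself is a permutation. *)
Lemma invertible_hallP (V : finType) (H : {set {set V}}) :
  invertible H <-> forall S : {set V},
    #|S| <= #|[set y | [exists x in S, [forall E in H, (x \in E) ==> (y \notin E)]]]|.
Proof.
split=> [[pi piH] S|hall].
  rewrite -(card_imset S (@perm_inj _ pi)); apply/subset_leq_card/subsetP.
  move=> _ /imsetP[x xS ->]; rewrite inE; apply/existsP; exists x; rewrite xS /=.
  apply/forallP=> E; apply/implyP=> EH; apply/implyP=> xE; apply/negP=> pixE.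
  by have /setP/(_ (pi x)) := piH E EH; rewrite !inE pixE imset_f.
have [|f finj fP] := @hall_matching _
    (fun x y => [forall E in H, (x \in E) ==> (y \notin E)]) [set: V] [set: V].
  move=> S _; apply: leq_trans (hall S) _.
  by apply/subset_leq_card/subsetP=> y; rewrite !inE.
have fI : injective f by move=> x y; apply: finj.
exists (perm fI) => E EH; apply/setP=> y; rewrite !inE; apply/andP=> -[/imsetP[x xE ->]].
rewrite permE; apply/negP; have /andP[_ /forallP/(_ E)] := fP x (in_setT x).
by rewrite EH xE.
Qed.

(* Adding isolated vertices, one fewer than [G] has, makes [G] itself violate
   Hall's condition by exactly one. *)
Lemma critical_of_complete_cover (d n : nat) :
  cover_size complete d n -> n = 0 \/ critical_size d n.
Proof.
case=> G [H [cG /minimal_edge_coverP[covH priv] degH <-]].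
have [->|[E0 E0H]] := set_0Vmem H; [by left; rewrite cards0 | right].
have [a0 [b0 [ab0 _]]] := priv E0 E0H.
have ab0n : a0 != b0 by apply/eqP=> e; move: ab0; rewrite e adj_irr.
have G0 : 0 < #|G| by apply/card_gt0P; exists a0.
have inlI : injective (@inl G 'I_#|G|.-1) by move=> ? ? [].
have inrI : injective (@inr G 'I_#|G|.-1) by move=> ? ? [].
pose lft (E : {set G}) : {set G + 'I_#|G|.-1} := inl @: E.
have lftI : injective lft by apply: imset_inj.
have in_lft x E : (inl x \in lft E) = (x \in E) by rewrite /lft mem_imset.
have nin_lft i E : (inr i \in lft E) = false by apply/imsetP=> -[].
pose iso : {set G + 'I_#|G|.-1} := inr @: [set: 'I_#|G|.-1].
have cardr : #|iso| = #|G|.-1 by rewrite card_imset // cardsT card_ord.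
exists (G + 'I_#|G|.-1)%type, (lft @: H); split; last exact: card_imset.
- split.
    move=> /invertible_hallP/(_ (lft [set: G])); rewrite card_imset // cardsT => leGN.
    suff /subset_leq_card/(leq_trans leGN) : [set v | [exists u in lft [set: G],
        [forall F in lft @: H, (u \in F) ==> (v \notin F)]]] \subset iso.
      by rewrite cardr leqNgt ltn_predL G0.
    apply/subsetP=> -[y|i _]; last by rewrite imset_f.
    rewrite inE => /existsP[_ /andP[/imsetP[x _ ->] /forallP xy]].
    have cov u v : u != v -> exists2 E, E \in H & (u \in E) && (v \in E).
      by move=> /cG/covH[E EH]; rewrite subUset !sub1set; exists E.
    have [E EH /andP[xE yE]] : exists2 E, E \in H & (x \in E) && (y \in E).
      have [<-|/cov//] := eqVneq x y.
      have [xa|/cov[E EH /andP[xE _]]] := eqVneq x a0; last by exists E; rewrite ?xE.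
      have /cov[E EH /andP[xE _]] : x != b0 by rewrite xa.
      by exists E; rewrite ?xE.
    by have := xy (lft E); rewrite imset_f // !in_lft xE yE.
  move=> _ /imsetP[E EH ->]; have [x [y [xy xyE]]] := priv E EH.
  (* Once [E] is removed, an isolated vertex in [S] is free for everything. Otherwise a nonempty [S]
     has all of [iso] as neighbours, so only [S] equal to all of [G] could fail; but if [x] is in
     [S], then [y] is an extra neighbour. *)
  apply/invertible_hallP=> S; set N := [set _ | _].
  have [i iS|noi] := pickP (fun i => inr i \in S).
    rewrite (leq_trans (max_card _)) // -cardsT; apply/subset_leq_card/subsetP=> z _.
    rewrite inE; apply/existsP; exists (inr i); rewrite iS /=.
    apply/forallP=> F; apply/implyP; rewrite inE => /andP[_ /imsetP[E' _ ->]].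
    by rewrite nin_lft.
  have sSG : S \subset lft [set: G].
    by apply/subsetP=> -[z _|i]; rewrite ?in_lft ?inE // noi.
  have rN z : z \in S -> iso \subset N.
    move=> zS; apply/subsetP=> _ /imsetP[i _ ->]; rewrite inE; apply/existsP; exists z.
    rewrite zS /=; apply/forallP=> F; apply/implyP; rewrite inE => /andP[_ /imsetP[E' _ ->]].
    by rewrite nin_lft implybT.
  have [->|[z zS]] := set_0Vmem S; first by rewrite cards0.
  have [xS|xS] := boolP (inl x \in S).
    apply: leq_trans (subset_leq_card sSG) _.
    rewrite card_imset // cardsT; apply: leq_trans (leqSpred _) _; rewrite -[X in X < _]cardr.
    apply/proper_card/properP; split; first exact: rN zS.
    exists (inl y); last by apply/imsetP=> -[].
    rewrite inE; apply/existsP; exists (inl x); rewrite xS /=.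
    apply/forallP=> F; apply/implyP; rewrite !inE => /andP[neF /imsetP[E' E'H defF]].
    rewrite defF !in_lft; apply/implyP=> xE'; apply/negP=> yE'.
    by move: neF; rewrite defF (xyE E') // eqxx.
  apply: leq_trans (subset_leq_card (rN z zS)).
  rewrite cardr -ltnS; apply: leq_trans (leqSpred _).
  rewrite -[X in _ < X]cardsT -[X in _ < X](card_imset _ inlI).
  apply/proper_card/properP; split=> //; exists (inl x) => //.
  by rewrite in_lft.
- move=> [x|i]; last first.
    rewrite (_ : [set _ in _ | _] = set0) ?cards0 //.
    by apply/setP=> F; rewrite !inE; apply/andP=> -[/imsetP[E _ ->]]; rewrite nin_lft.
  apply: leq_trans (degH x); rewrite -(card_imset _ lftI).
  apply/subset_leq_card/subsetP=> F; rewrite inE => /andP[/imsetP[E EH ->]].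
  by rewrite in_lft => xE; rewrite imset_f // inE EH.
Qed.

(** * From critical hypergraphs to bipartite covers: i(d) <= b(d) *)

Section SumGraph.
Variables L R : finType.

(** The sum type keeps the two classes disjoint even when they come from overlapping subsets of one
    vertex set. *)
Definition sum_adj (u v : L + R) : bool :=
  (if u is inl _ then true else false) != (if v is inl _ then true else false).

Lemma sum_adj_sym : symmetric sum_adj.
Proof. by case=> ? [?|?]. Qed.

Lemma sum_adj_irr : irreflexive sum_adj.
Proof. by case. Qed.

Definition sum_graph : sgraph := SGraph sum_adj_sym sum_adj_irr.

Lemma sum_graph_bipartite : complete_bipartite sum_graph.
Proof.
by exists [set u : L + R | if u is inl _ then true else false] => x y; rewrite !inE.
Qed.

End SumGraph.

(* A set [S] violating Hall's condition and the vertices [T] not matchable to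
   [S] satisfy [#|S| + #|T| > #|V|], and [H] covers [S * T]. *)
Lemma bipartite_cover_of_critical (d n : nat) :
  critical_size d n -> cover_size complete_bipartite d n.
Proof.
case=> V [H [[ninv crit] degH <-]].
pose free (x y : V) := [forall E in H, (x \in E) ==> (y \notin E)].
have [S ltS] : exists S : {set V}, #|[set y | [exists x in S, free x y]]| < #|S|.
  apply: NNPP => none; apply/ninv/invertible_hallP=> S; rewrite leqNgt.
  by apply/negP=> ltS; apply: none; exists S.
set N := [set y | _] in ltS; pose T := ~: N.
have covST x y : x \in S -> y \in T -> exists2 E, E \in H & (x \in E) && (y \in E).
  move=> xS; rewrite !inE => /existsPn/(_ x); rewrite xS /= => /forallPn[E].
  by rewrite !negb_imply andbT => /andP[EH xyE]; exists E.
have priv E : E \in H -> exists x y, [/\ x \in S, y \in T &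
    forall E', E' \in H -> x \in E' -> y \in E' -> E' = E].
  move=> EH; have [pi piH] := crit E EH.
  (* [pi @: S] is larger than [N], so some [pi x] lies in [T]. As [pi] inverts every other edge,
     only [E] can contain both [x] and [pi x]. *)
  have /set0Pn[_ /setIP[/imsetP[x xS ->] pixT]] : (pi @: S) :&: T != set0.
    apply/eqP=> /eqP; rewrite setI_eq0 disjoints_subset setCK => /subset_leq_card.
    by rewrite (card_imset _ (@perm_inj _ pi)) leqNgt ltS.
  exists x, (pi x); split=> // E' E'H xE' pixE'; apply/eqP/negPn/negP=> neE.
  have /piH/setP/(_ (pi x)) : E' \in H :\ E by rewrite !inE neE.
  by rewrite !inE pixE' imset_f.
pose G := sum_graph {x | x \in S} {y | y \in T}.
pose p (u : G) : V := match u with inl x => val x | inr y => val y end.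
have priv' E : E \in H -> exists u v : G, adj u v /\
    forall E', E' \in H -> p u \in E' -> p v \in E' -> E' = E.
  move=> /priv[x [y [xS yT xyE]]].
  by exists (inl (exist _ x xS)), (inr (exist _ y yT)).
have cov' (u v : G) : adj u v -> exists2 E, E \in H & (p u \in E) && (p v \in E).
  case: u v => [[x xS]|[x xT]] [[y yS]|[y yT]] //= _; first exact: covST.
  by have [E EH yx] := covST y x yS xT; exists E; rewrite // andbC.
pose pre (E : {set V}) : {set G} := p @^-1: E.
have in_pre u E : (u \in pre E) = (p u \in E) by rewrite inE.
exists G, (pre @: H); split.
- exact: sum_graph_bipartite.
- apply/minimal_edge_coverP; split.
    move=> u v /cov'[E EH /andP[uE vE]]; exists (pre E); rewrite ?imset_f //.
    by rewrite subUset !sub1set !in_pre uE.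
  move=> _ /imsetP[E /priv'[u [v [uv uvE]]] ->]; exists u, v; split=> //.
  by move=> _ /imsetP[E' E'H ->]; rewrite !in_pre => uE' vE'; rewrite (uvE E').
- move=> u; apply: leq_trans (degH (p u)).
  apply: leq_trans (leq_imset_card pre _).
  apply/subset_leq_card/subsetP=> F; rewrite inE => /andP[/imsetP[E EH ->]].
  by rewrite in_pre => uE; rewrite imset_f // inE EH.
(* Restriction to [G] loses no edge: the private pair of [E] lies in [pre E], hence in [E'] too if
   the preimages agree. *)
apply: card_in_imset => E E' EH E'H eqE.
have [u [v [uv uvE]]] := priv' E EH.
have [E1 E1H /andP[uE1 vE1]] := cov' u v uv.
have defE1 := uvE E1 E1H uE1 vE1; rewrite {}defE1 in uE1 vE1.
apply/esym/uvE => //.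
  by have /setP/(_ u) := eqE; rewrite !in_pre uE1.
by have /setP/(_ v) := eqE; rewrite !in_pre vE1.
Qed.

(** * From bipartite to complete covers: b(d) <= c(d+1) *)

Lemma neq_sym (T : eqType) : symmetric (fun x y : T => x != y).
Proof. by move=> x y; rewrite eq_sym. Qed.

Lemma neq_irr (T : eqType) : irreflexive (fun x y : T => x != y).
Proof. by move=> x; rewrite eqxx. Qed.

Definition complete_graph (T : finType) : sgraph := SGraph (@neq_sym T) (@neq_irr T).

(* Adding both vertex classes as edges covers the complete graph, and every
   member of the old cover is still needed for its private crossing pair. *)
Lemma complete_cover_of_bipartite (d n : nat) :
  cover_size complete_bipartite d n ->
  exists2 m, n <= m & cover_size complete d.+1 m.
Proof.
case=> G [H [[A bip] /minimal_edge_coverP[covH priv] degH <-]].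
pose K := complete_graph G.
pose H1 : {set {set K}} := H :|: [set A; ~: A].
have cov1 : edge_cover H1.
  move=> x y _; case xA: (x \in A); case yA: (y \in A).
  - by exists A; rewrite ?inE ?eqxx ?orbT // subUset !sub1set xA.
  - have [|E EH sE] := covH x y; first by rewrite bip xA yA.
    by exists E; rewrite // inE EH.
  - have [|E EH sE] := covH x y; first by rewrite bip xA yA.
    by exists E; rewrite // inE EH.
  - by exists (~: A); rewrite ?inE ?eqxx ?orbT // subUset !sub1set !inE xA yA.
(* A class added as an edge may be redundant, so a minimal subcover is taken; only members of [H]
   are sure to survive. *)
have [H2 sH2 min2] := minimal_edge_cover_sub cov1.
exists #|H2|.
  apply/subset_leq_card/subsetP=> E EH; have [x [y [xy xyE]]] := priv E EH.
  have [|E2 E2H2] := min2.1 x y.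
    by apply/eqP=> eqxy; move: xy; rewrite eqxy adj_irr.
  rewrite subUset !sub1set => /andP[xE2 yE2].
  have := subsetP sH2 _ E2H2; rewrite !inE => /orP[E2H|/orP[]/eqP defE2].
  - by rewrite -(xyE E2).
  - by move: xy; rewrite bip -defE2 xE2 yE2.
  - by move: xE2 yE2 xy; rewrite defE2 !inE bip => /negbTE-> /negbTE->.
exists K, H2; split=> //.
(* Each vertex lies in exactly one of [A] and [~: A], so its degree grows by at most one. *)
move=> x; apply: leq_trans (_ : #|(if x \in A then A else ~: A) |: [set E in H | x \in E]| <= _).
  apply/subset_leq_card/subsetP=> E; rewrite !inE => /andP[/(subsetP sH2)].
  rewrite !inE => /orP[->|/orP[]/eqP->]; first by move=> ->; rewrite orbT.
    by move=> ->; rewrite eqxx.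
  by rewrite inE => /negbTE->; rewrite eqxx.
by rewrite cardsU1 -add1n; apply: leq_add (degH x); case: (_ \notin _).
Qed.

(** * Attained sizes and comparison of the maxima *)

Lemma cover_size_complete0 (d : nat) : cover_size complete d 0.
Proof.
exists (complete_graph unit), set0; split=> //; last by rewrite cards0.
- by apply/minimal_edge_coverP; split=> [[] []|E]; rewrite ?inE.
- by move=> x; rewrite (_ : [set _ in _ | _] = set0) ?cards0 //; apply/setP=> E; rewrite !inE.
Qed.

(** On one vertex the only permutation is the identity, which fixes the singleton edge. This starts
    the search for the maxima i(d) and b(d). *)
Lemma critical_size1 (d : nat) : 0 < d -> critical_size d 1.
Proof.
move=> d0; exists unit, [set [set tt]]; split; last by rewrite cards1.
- split=> [[pi /(_ _ (set11 _))/setP/(_ tt)]|E /set1P->].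
    by rewrite !inE (_ : tt = pi tt) ?imset_f ?inE //; case: (pi tt).
  by exists 1%g => F; rewrite !inE andNb.
- move=> x; apply: leq_trans d0; rewrite -(cards1 [set tt]).
  by apply/subset_leq_card/subsetP=> E; rewrite inE => /andP[].
Qed.

Theorem theorem1p2 (d : nat) (hd : 1 <= d) :
  exists c0 i0 b0 c1 : nat,
    [/\ is_c d c0, is_i d i0, is_b d b0 & is_c d.+1 c1] /\
    [/\ c0 <= i0, i0 <= b0 & b0 <= c1].
Proof.
(* The bound for c(d+1) also bounds b(d), and through it i(d). *)
have bound_b n : cover_size complete_bipartite d n -> n <= d.+2 ^ d.+2.
  by case/complete_cover_of_bipartite=> m le_nm /complete_cover_size_bound; apply: leq_trans.
have crit1 := critical_size1 hd.
have [c0 c0P] := is_maximum_exists (cover_size_complete0 d) (@complete_cover_size_bound d).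
have [c1 c1P] := is_maximum_exists (cover_size_complete0 d.+1) (@complete_cover_size_bound d.+1).
have [b0 b0P] := is_maximum_exists (bipartite_cover_of_critical crit1) bound_b.
have [i0 i0P] := is_maximum_exists crit1 (fun n Pn => bound_b n (bipartite_cover_of_critical Pn)).
exists c0, i0, b0, c1; do 2!split=> //.
- by case: (critical_of_complete_cover c0P.1) => [->|/i0P.2].
- exact/b0P.2/bipartite_cover_of_critical/i0P.1.
- by have [m le_m /c1P.2] := complete_cover_of_bipartite b0P.1; apply: leq_trans.
Qed.
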